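(* Let $(\mathcal{W},\mathcal{V})$ be an AVWC with finite alphabets $\mathcal{X},\mathcal{Y},\mathcal{Z}$, finite state set $\mathcal{S}$, cost function $c:\mathcal{S}\to[0,\infty)$ and cost constraint $\Lambda>0$ on the states. Then every real number $R\ge0$ satisfying \[ R \leq \max_{U} \Big[\min_{q\in\mathcal{P}(\mathcal{S},\Lambda)}I(U;Y_q) - \max_{q'\in\mathcal{P}(\mathcal{S},\Lambda)}\bar{I}_{q'}(U; Z_{\mathcal{S}})\Big] \] is achievable by random code (with respect to the maximal decoding error probability and the strong secrecy criterion) over that AVWC with cost constraint $\Lambda$ on the states. Here the maximum is over $U$ on a finite alphabet with joint pmf $P_{UX}$, $\Pr\{U=u,Y_q=y\}=\sum_xP_{UX}(u,x)W_q(y|x)$, $\Pr\{U=u,Z_s=z\}=\sum_xP_{UX}(u,x)V_s(z|x)$.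
   Context: AVWC $(\mathcal{W},\mathcal{V})$: $\mathcal{W}=\{W_s\}_{s\in\mathcal{S}}$ transition matrices $\mathcal{X}\to\mathcal{Y}$, $\mathcal{V}=\{V_s\}_{s\in\mathcal{S}}$ transition matrices $\mathcal{X}\to\mathcal{Z}$; $W(y^N|x^N,s^N)=\prod_iW_{s_i}(y_i|x_i)$, $V(z^N|x^N,s^N)=\prod_iV_{s_i}(z_i|x_i)$; states unknown to transmitter and receiver. $\mathcal{P}(\mathcal{S})$ = pmfs on $\mathcal{S}$; $W_q=\sum_sq(s)W_s$. For $q\in\mathcal{P}(\mathcal{S})$, $\bar I_q(U;Z_{\mathcal{S}})=\sum_{s\in\mathcal{S}}q(s)I(U;Z_s)$. Costs: $c(s^N)=\frac1N\sum_{i=1}^Nc(s_i)$, $c(q)=\sum_sc(s)q(s)$, $\mathcal{P}(\mathcal{S},\Lambda)=\{q\in\mathcal{P}(\mathcal{S}):c(q)\le\Lambda\}$. A random code of length $N$ is a random pair $(F,\Phi)$ over a finite family $\{(f_g,\phi_g)\}$ of deterministic codes $f_g:\mathcal{M}\to\mathcal{X}^N$, $\phi_g:\mathcal{Y}^N\to\mathcal{M}$. For $s^N$, $\lambda(\mathcal{W},F,\Phi,s^N)=\max_mE[1-W(\Phi^{-1}(m)|F(m),s^N)]$ with $W(D|x^N,s^N)=\sum_{y^N\in D}W(y^N|x^N,s^N)$, and $\lambda(\mathcal{W},F,\Phi,\Lambda)=\max_{s^N:c(s^N)\le\Lambda}\lambda(\mathcal{W},F,\Phi,s^N)$. $M$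 is uniform on $\mathcal{M}$ and independent of $(F,\Phi)$, $X^N=F(M)$, and $Z^N(s^N)$ satisfies $\Pr\{Z^N(s^N)=z^N|X^N=x^N,M,F,\Phi\}=V(z^N|x^N,s^N)$. $R\ge0$ is achievable by random code over the AVWC with cost constraint $\Lambda$ if for every $\epsilon>0$ and all sufficiently large $N$ there is a random code with $\frac1N\log|\mathcal{M}|>R-\epsilon$, $\lambda(\mathcal{W},F,\Phi,\Lambda)<\epsilon$ and $\max_{s^N:c(s^N)\le\Lambda}I(M;Z^N(s^N)|\Phi)<\epsilon$. *)

(* Defs.v *)
From HB Require Import structures.
From mathcomp Require Import all_boot all_order all_algebra.
From mathcomp Require Import reals exp.

Set Implicit Arguments.
Unset Strict Implicit.
Unset Printing Implicit Defensive.

Import Order.TTheory GRing.Theory Num.Theory.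
Local Open Scope ring_scope.

Section InfoDefs.
Variable R : realType.

Definition is_pmf (T : finType) (p : T -> R) : Prop :=
  (forall t, 0 <= p t) /\ \sum_t p t = 1.

Definition channel (S X Y : finType) (W : S -> X -> Y -> R) : Prop :=
  forall s x, is_pmf (W s x).

Definition marg1 (A B : finType) (P : A * B -> R) (a : A) : R :=
  \sum_(b : B) P (a, b).
Definition marg2 (A B : finType) (P : A * B -> R) (b : B) : R :=
  \sum_(a : A) P (a, b).

Definition mutinfo (A B : finType) (P : A * B -> R) : R :=
  \sum_(ab : A * B)
    (if P ab == 0 then 0
     else P ab * ln (P ab / (marg1 P ab.1 * marg2 P ab.2))).

Definition condmutinfo (A B C : finType) (P : A * B * C -> R) : R :=
  let PC  := fun c : C => \sum_(ab : A * B) P (ab, c) in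
  let PAC := fun (a : A) (c : C) => \sum_(b : B) P ((a, b), c) in
  let PBC := fun (b : B) (c : C) => \sum_(a : A) P ((a, b), c) in
  \sum_(t : A * B * C)
    (if P t == 0 then 0
     else P t * ln (P t * PC t.2 / (PAC t.1.1 t.2 * PBC t.1.2 t.2))).

Definition avg_chan (S X Y : finType) (W : S -> X -> Y -> R) (q : S -> R)
  (x : X) (y : Y) : R := \sum_(s : S) q s * W s x y.

Definition cost_pmf (S : finType) (c : S -> R) (q : S -> R) : R :=
  \sum_(s : S) c s * q s.
Definition in_PSL (S : finType) (c : S -> R) (Lam : R) (q : S -> R) : Prop :=
  is_pmf q /\ cost_pmf c q <= Lam.

Definition joint_UY (U X Y S : finType) (PUX : U * X -> R)
  (W : S -> X -> Y -> R) (q : S -> R) (uy : U * Y) : R :=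
  \sum_(x : X) PUX (uy.1, x) * avg_chan W q x uy.2.
Definition joint_UZs (U X Z S : finType) (PUX : U * X -> R)
  (V : S -> X -> Z -> R) (s : S) (uz : U * Z) : R :=
  \sum_(x : X) PUX (uz.1, x) * V s x uz.2.

Definition Ibar (U X Z S : finType) (PUX : U * X -> R)
  (V : S -> X -> Z -> R) (q : S -> R) : R :=
  \sum_(s : S) q s * mutinfo (joint_UZs PUX V s).

Definition chanN (N : nat) (S X Y : finType) (W : S -> X -> Y -> R)
  (sN : {ffun 'I_N -> S}) (xN : {ffun 'I_N -> X}) (yN : {ffun 'I_N -> Y}) : R :=
  \prod_(i < N) W (sN i) (xN i) (yN i).

Definition costN (N : nat) (S : finType) (c : S -> R) (sN : {ffun 'I_N -> S}) : R :=
  (N%:R)^-1 * \sum_(i < N) c (sN i).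

(* Random code: a finite family G of deterministic codes (f g, phi g) with
   distribution PG; messages are 'I_m.
   E[1 - W(Phi^{-1}(msg) | F(msg), s^N)] : *)
Definition rc_err (N m : nat) (S X Y G : finType) (W : S -> X -> Y -> R)
  (PG : G -> R) (f : G -> 'I_m -> {ffun 'I_N -> X})
  (phi : G -> {ffun {ffun 'I_N -> Y} -> 'I_m})
  (sN : {ffun 'I_N -> S}) (msg : 'I_m) : R :=
  \sum_(g : G) PG g *
     (1 - \sum_(yN : {ffun 'I_N -> Y} | phi g yN == msg) chanN W sN (f g msg) yN).

(* joint pmf of (M, Z^N(s^N), Phi), M uniform and independent of (F, Phi) *)
Definition rc_joint_MZPhi (N m : nat) (S X Y Z G : finType) (V : S -> X -> Z -> R)
  (PG : G -> R) (f : G -> 'I_m -> {ffun 'I_N -> X})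
  (phi : G -> {ffun {ffun 'I_N -> Y} -> 'I_m})
  (sN : {ffun 'I_N -> S})
  (t : 'I_m * {ffun 'I_N -> Z} * {ffun {ffun 'I_N -> Y} -> 'I_m}) : R :=
  \sum_(g : G | phi g == t.2) (m%:R)^-1 * PG g * chanN V sN (f g t.1.1) t.1.2.

Definition achievable_rc (S X Y Z : finType) (W : S -> X -> Y -> R)
  (V : S -> X -> Z -> R) (c : S -> R) (Lam Rt : R) : Prop :=
  forall eps : R, 0 < eps -> exists N0 : nat, forall N : nat, (N0 <= N)%N ->
  exists (m : nat) (G : finType) (PG : G -> R)
         (f : G -> 'I_m -> {ffun 'I_N -> X})
         (phi : G -> {ffun {ffun 'I_N -> Y} -> 'I_m}),
    [/\ (0 < m)%N, is_pmf PG,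
        ln (m%:R) / N%:R > Rt - eps,
        (forall sN : {ffun 'I_N -> S}, costN c sN <= Lam ->
           forall msg : 'I_m, rc_err W PG f phi sN msg < eps) &
        (forall sN : {ffun 'I_N -> S}, costN c sN <= Lam ->
           condmutinfo (rc_joint_MZPhi V PG f phi sN) < eps)].

End InfoDefs.

(* Main.v *)
Require Import Defs.
From HB Require Import structures.
From mathcomp Require Import all_boot all_order all_algebra.
From mathcomp Require Import boolp classical_sets reals sequences exp.
From mathcomp Require Import ring lra.
Import Order.TTheory GRing.Theory Num.Theory.
Local Open Scope ring_scope.

Set Implicit Arguments.
Unset Strict Implicit.
Unset Printing Implicit Defensive.

(** After absorbing the prefix [P_{X|U}] into the channels (the map [u -> x]
    is drawn by the encoder alone), take an iid codebook with [M * L] codewords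
    as shared randomness, the index in [1..L] being private encoder randomness.

    Secrecy: by soft covering, the expected divergence between the eavesdropper
    output and its iid average is at most
    [E ln (1 + exp (sum_i i_{s_i}) / L) <= L^{-t} E exp (t * sum_i i_{s_i}) / t],
    which is exponentially small once [ln L / N] exceeds [max_q' Ibar_q'].

    Decoding: for every empirical distribution [q] of states, compare the
    likelihood ratio of the averaged channel [W_q] with [exp (N * tau)]. A wrong
    codeword passes with probability at most [(N+1)^|S| exp (-N * tau)]. The
    transmitted one passes the test for the true type [q] of the state sequence
    by a Chernoff bound: the product over [i] of the moments for [W_{s_i}] is
    governed by their average, the moment for [W_q], hence by [I(U; Y_q)]. *)


(** * Scalar inequalities for the exponential and the logarithm *)

Section Elementary.
Variable R : realType.
Implicit Types x y t : R.

Lemma ln_le_subr1 x : 0 < x -> ln x <= x - 1.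
Proof.
move=> x0; have := @le_ln1Dx R (x - 1); rewrite [1 + _]addrC subrK; apply; lra.
Qed.

(** For [0 <= x], apply [expR y - 1 <= y * expR y] twice. For [x < 0], [x <= expR x - 1] gives
    [x * (expR x - 1) <= x ^+ 2], and the last factor is at least 1. *)
Lemma expR_le_taylor2 x : expR x <= 1 + x + x ^+ 2 * expR `|x|.
Proof.
have slope y : expR y - 1 <= y * expR y.
  have := expR_ge1Dx (- y); rewrite expRN => h.
  have := ler_wpM2r (expR_ge0 y) h.
  by rewrite mulVf ?gt_eqF ?expR_gt0//; lra.
have sx := slope x; have lx := expR_ge1Dx x.
have [x0|x0] := leP 0 x; last first.
  rewrite ltr0_norm//.
  have e1 : 1 <= expR (- x) by have := expR_ge1Dx (- x); lra.
  have e2 : x * (expR x - 1) <= x ^+ 2 by rewrite expr2; nra.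
  have e3 : x ^+ 2 <= x ^+ 2 * expR (- x) by rewrite ler_peMr ?sqr_ge0.
  lra.
rewrite ger0_norm//.
have : x * (expR x - 1) <= x ^+ 2 * expR x by rewrite expr2 -mulrA ler_wpM2l.
lra.
Qed.

Lemma sqr_le_expR_half x : 0 <= x -> x ^+ 2 <= 16 * expR (x / 2).
Proof.
move=> x0; have h := expR_ge1Dx (x / 4).
have -> : x / 2 = x / 4 + x / 4 by lra.
rewrite expRD.
have h4 : x <= 4 * expR (x / 4) by lra.
have : x * x <= (4 * expR (x / 4)) * (4 * expR (x / 4)) by rewrite ler_pM.
by rewrite expr2; lra.
Qed.

(** Turns the logarithm of soft covering into an exponential moment. For [y <= 0] the left side is
    at most [expR y <= expR (t * y)]; for [0 < y] it is at most [1 + y], and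
    [t * (1 + y) <= 1 + t * y]. *)
Lemma ln1DexpR_le t y : 0 < t <= 1 -> ln (1 + expR y) <= expR (t * y) / t.
Proof.
move=> /andP[t0 t1]; rewrite ler_pdivlMr//.
have e0 := expR_gt0 y.
have [y0|y0] := leP y 0.
  have h : ln (1 + expR y) <= expR y by apply: le_ln1Dx; lra.
  have h2 : expR y <= expR (t * y) by rewrite ler_expR; nra.
  have h3 : 0 <= expR y * (1 - t) by rewrite mulr_ge0; lra.
  have : ln (1 + expR y) * t <= expR y * t by rewrite ler_wpM2r// ltW.
  lra.
have e1 : 1 < expR y by rewrite expR_gt1.
have h : ln (1 + expR y) <= 1 + y.
  apply: (@le_trans _ _ (ln (2 * expR y))).
    by rewrite ler_ln ?posrE; lra.
  rewrite lnM ?posrE// expRK lerD2r.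
  by have := @ln_le_subr1 2; lra.
have := expR_ge1Dx (t * y).
have : ln (1 + expR y) * t <= (1 + y) * t by rewrite ler_wpM2r// ltW.
lra.
Qed.

(** The exponential dominates [(b * N.+1) ^ d.+1], one power more than the polynomial has; the spare
    power leaves [C / N.+1]. *)
Lemma poly_expR_small (d : nat) (a e : R) : 0 < a -> 0 < e ->
  exists N0 : nat, forall N : nat, (N0 <= N)%N ->
    N.+1%:R ^+ d * expR (- (a * N%:R)) < e.
Proof.
move=> a0 e0.
pose b := a / d.+1%:R; have b0 : 0 < b by rewrite divr_gt0.
pose C := expR a / b ^+ d.+1.
have C0 : 0 < C by rewrite divr_gt0 ?exprn_gt0 ?expR_gt0.
exists (Num.trunc (C / e)) => N hN.
have hN1 : C / e < N.+1%:R.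
  by apply: lt_le_trans (truncnS_gt _) _; rewrite ler_nat ltnS.
have h1 : (b * N.+1%:R) ^+ d.+1 <= expR (a * N.+1%:R).
  have -> : a * N.+1%:R = d.+1%:R * (b * N.+1%:R).
    by rewrite mulrA /b [d.+1%:R * _]mulrC divfK ?pnatr_eq0.
  rewrite expRM_natl lerXn2r ?nnegrE ?expR_ge0//.
    by rewrite mulr_ge0// ltW.
  by have := expR_ge1Dx (b * N.+1%:R); lra.
have eE : expR (- (a * N%:R)) = expR a / expR (a * N.+1%:R).
  by rewrite -expRB -addn1 natrD; congr expR; lra.
rewrite eE.
have bN0 : 0 < (b * N.+1%:R) ^+ d.+1 by apply: exprn_gt0; apply: mulr_gt0.
apply: (@le_lt_trans _ _ (N.+1%:R ^+ d * (expR a / (b * N.+1%:R) ^+ d.+1))).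
  rewrite ler_wpM2l ?exprn_ge0// ler_wpM2l ?expR_ge0//.
  by rewrite lef_pV2 ?posrE ?expR_gt0.
have -> : N.+1%:R ^+ d * (expR a / (b * N.+1%:R) ^+ d.+1) = C / N.+1%:R.
  rewrite /C exprMn [N.+1%:R ^+ d.+1]exprS; field.
  by rewrite nat1r !expf_neq0 ?pnatr_eq0 ?gt_eqF.
by rewrite ltr_pdivrMr// mulrC -ltr_pdivrMr.
Qed.

End Elementary.

(** * Sums of products over words, and iid laws *)

Section Products.
Variable R : realType.

Lemma sum_prod_ffun (I T : finType) (F : I -> T -> R) :
  \sum_(f : {ffun I -> T}) \prod_i F i (f i) = \prod_i \sum_t F i t.
Proof. by rewrite bigA_distr_bigA. Qed.

Lemma sum2_prod_ffun (I A B : finType) (F : I -> A -> B -> R) :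
  \sum_(f : {ffun I -> A}) \sum_(g : {ffun I -> B}) \prod_i F i (f i) (g i) =
  \prod_i \sum_a \sum_b F i a b.
Proof.
rewrite -sum_prod_ffun; apply: eq_bigr => f _.
by rewrite -[RHS]sum_prod_ffun.
Qed.

Definition iid (I T : finType) (p : T -> R) (f : {ffun I -> T}) : R :=
  \prod_i p (f i).

Lemma is_pmf_iid (I T : finType) (p : T -> R) :
  is_pmf p -> is_pmf (@iid I T p).
Proof.
move=> [p0 p1]; split=> [f|]; first exact: prodr_ge0.
by rewrite (sum_prod_ffun (fun _ => p)) big1.
Qed.

Lemma is_pmf_chanN (N : nat) (S A B : finType) (W : S -> A -> B -> R)
  (s : {ffun 'I_N -> S}) (x : {ffun 'I_N -> A}) :
  channel W -> is_pmf (chanN W s x).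
Proof.
move=> hW; split=> [y|]; first by apply: prodr_ge0 => i _; case: (hW (s i) (x i)).
rewrite /chanN (sum_prod_ffun (fun i y => W (s i) (x i) y)) big1// => i _.
by case: (hW (s i) (x i)).
Qed.

(** The law may change with the coordinate: a random prefix map takes at each [u] a value of law
    [k u]. *)
Lemma indep_marginal (I T : finType) (k : I -> T -> R) (i : I) (g : T -> R) :
  (forall j, is_pmf (k j)) ->
  \sum_(f : {ffun I -> T}) (\prod_j k j (f j)) * g (f i) = \sum_t k i t * g t.
Proof.
move=> hk.
transitivity (\sum_(f : {ffun I -> T})
    \prod_j (k j (f j) * (if j == i then g (f j) else 1))).
  apply: eq_bigr => f _; rewrite big_split/=; congr (_ * _).
  by rewrite (bigD1 i)//= eqxx big1 ?mulr1// => j /negPf ->.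
rewrite (sum_prod_ffun (fun j t => k j t * (if j == i then g t else 1))).
rewrite (bigD1 i)//= eqxx [X in _ * X]big1 ?mulr1// => j /negPf ->.
by under eq_bigr do rewrite mulr1; case: (hk j).
Qed.

Variables (I T : finType) (p : T -> R).
Hypothesis hp : is_pmf p.

Lemma iid_prodE (h : I -> T -> R) :
  \sum_f iid p f * (\prod_i h i (f i)) = \prod_i \sum_t p t * h i t.
Proof.
by rewrite -sum_prod_ffun; apply: eq_bigr => f _; rewrite -big_split.
Qed.

Lemma iid_marginal (i : I) (g : T -> R) :
  \sum_f iid p f * g (f i) = \sum_t p t * g t.
Proof. exact: (@indep_marginal I T (fun=> p) i g (fun=> hp)). Qed.

(** The indicator of a pair of values is a product of one-coordinate functions, so [iid_prodE]
    settles it; linearity extends this to every [g]. *)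
Lemma iid_marginal2 (i j : I) (g : T -> T -> R) : i != j ->
  \sum_f iid p f * g (f i) (f j) = \sum_s \sum_t p s * p t * g s t.
Proof.
move=> ij.
have ptE s t : \sum_f iid p f * ((f i == s) && (f j == t))%:R = p s * p t.
  pose h k u : R := if k == i then (u == s)%:R else
    if k == j then (u == t)%:R else 1.
  transitivity (\sum_f iid p f * \prod_k h k (f k)).
    apply: eq_bigr => f _.
    rewrite (bigD1 i)//= (bigD1 j)/=; last by rewrite eq_sym.
    rewrite big1 ?mulr1; last by move=> k /andP[/negPf ki /negPf kj]; rewrite /h ki kj.
    by rewrite /h eqxx [j == i]eq_sym (negPf ij) eqxx -natrM mulnb.
  rewrite iid_prodE (bigD1 i)//= (bigD1 j)/=; last by rewrite eq_sym.
  rewrite [X in _ * (_ * X)]big1 ?mulr1; last first.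
    move=> k /andP[/negPf ki /negPf kj]; rewrite /h ki kj.
    by under eq_bigr do rewrite mulr1; case: hp.
  have delta (u : T) : \sum_v p v * (v == u)%:R = p u.
    rewrite (bigD1 u)//= eqxx mulr1 big1 ?addr0// => v /negPf ->.
    by rewrite mulr0.
  by rewrite /h eqxx [j == i]eq_sym (negPf ij) eqxx !delta.
under [RHS]eq_bigr => s _ do under eq_bigr => t _ do rewrite -ptE mulr_suml.
under [RHS]eq_bigr => s _ do rewrite exchange_big.
rewrite [RHS]exchange_big; apply: eq_bigr => f _.
rewrite (bigD1 (f i))//= (bigD1 (f j))//= !eqxx mulr1.
rewrite big1 ?addr0 => [|t /negPf tj]; last first.
  by rewrite eq_sym tj mulr0 mul0r.
rewrite big1 ?addr0// => s /negPf si; rewrite big1// => t _.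
by rewrite eq_sym si mulr0 mul0r.
Qed.

End Products.


(** * One-shot random coding *)

Section CondMutInfo.
Variable R : realType.

Lemma sum_unif (m : nat) (x : R) : (0 < m)%N -> \sum_(i < m) (m%:R)^-1 * x = x.
Proof.
move=> m0; rewrite sumr_const card_ord -[LHS]mulr_natl mulrA mulfV ?mul1r//.
by rewrite pnatr_eq0 -lt0n.
Qed.

Variables (G Z D : finType) (m : nat) (PG : G -> R) (phi : G -> D).
Variables (k : G -> 'I_m -> Z -> R) (Q : Z -> R).
Hypotheses (m0 : (0 < m)%N) (hPG : is_pmf PG) (hQ : is_pmf Q).
Hypothesis hk : forall g a, is_pmf (k g a).
Hypothesis kQ : forall g a z, 0 < PG g -> 0 < k g a z -> 0 < Q z.

(* The bound is by a divergence given the full randomness [g], although the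
   receiver conditions only on [phi g]: one application of [ln x <= x - 1] does
   both the log-sum inequality and the replacement of the output law by [Q]. *)
Lemma condmutinfo_le :
  condmutinfo (fun t : 'I_m * Z * D =>
    \sum_(g | phi g == t.2) (m%:R)^-1 * PG g * k g t.1.1 t.1.2) <=
  \sum_a \sum_z \sum_g (m%:R)^-1 * PG g * k g a z * ln (k g a z / Q z).
Proof.
set P := fun t : 'I_m * Z * D => _.
have mV0 : 0 < (m%:R : R)^-1 by rewrite invr_gt0 ltr0n.
have PG0 g : 0 <= PG g by case: hPG.
have k0 g a z : 0 <= k g a z by case: (hk g a).
have Q0 z : 0 <= Q z by case: hQ.
pose e g a z := (m%:R)^-1 * PG g * k g a z.
have e0 g a z : 0 <= e g a z by rewrite !mulr_ge0// ltW.
pose Pd d := \sum_(g | phi g == d) PG g.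
pose Pzd z d := \sum_a P ((a, z), d).
have P0 t : 0 <= P t by apply: sumr_ge0 => g _; exact: e0.
have Pd0 d : 0 <= Pd d by exact: sumr_ge0.
have Pzd0 z d : 0 <= Pzd z d by exact: sumr_ge0.
have margC d : \sum_(ab : 'I_m * Z) P (ab, d) = Pd d.
  rewrite /P/= exchange_big; apply: eq_bigr => g _.
  rewrite -(pair_bigA _ (fun a z => (m%:R)^-1 * PG g * k g a z))/=.
  transitivity (\sum_(a < m) (m%:R)^-1 * PG g); last exact: sum_unif.
  by apply: eq_bigr => a _; rewrite -mulr_sumr; case: (hk g a) => _ ->; rewrite mulr1.
have margAC a d : \sum_(b : Z) P ((a, b), d) = (m%:R)^-1 * Pd d.
  rewrite /P/= exchange_big mulr_sumr; apply: eq_bigr => g _ /=.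
  by rewrite -mulr_sumr; case: (hk g a) => _ ->; rewrite mulr1.
pose rho t := P t * Pd t.2 / ((m%:R)^-1 * Pd t.2 * Pzd t.1.2 t.2).
have rho0 t : 0 <= rho t.
  by rewrite divr_ge0 ?mulr_ge0// ltW.
have -> : condmutinfo P = \sum_t P t * ln (rho t).
  rewrite /condmutinfo; apply: eq_bigr => t _.
  by rewrite margC margAC; case: eqP => [->|//]; rewrite mul0r.
have -> : \sum_t P t * ln (rho t) =
    \sum_a \sum_z \sum_g e g a z * ln (rho ((a, z), phi g)).
  rewrite -(pair_bigA _ (fun ab d => P (ab, d) * ln (rho (ab, d))))/=.
  rewrite -(pair_bigA _ (fun a z => \sum_d P ((a, z), d) * ln (rho ((a, z), d))))/=.
  apply: eq_bigr => a _; apply: eq_bigr => z _.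
  rewrite (partition_big phi predT)//=; apply: eq_bigr => d _.
  by rewrite mulr_suml; apply: eq_bigr => g /eqP ->.
(* [q] is [e] with [Q z] in place of [k g a z], so [e * (rho / (k / Q) - 1)] becomes [q * rho - e],
   which is also nonnegative where [e] vanishes. *)
pose q g z := (m%:R)^-1 * PG g * Q z.
have step : \sum_a \sum_z \sum_g e g a z * ln (rho ((a, z), phi g)) <=
    \sum_a \sum_z \sum_g (e g a z * ln (k g a z / Q z) +
      (q g z * rho ((a, z), phi g) - e g a z)).
  apply: ler_sum => a _; apply: ler_sum => z _; apply: ler_sum => g _.
  have := e0 g a z; rewrite le_eqVlt => /orP[/eqP<-|egt].
    by rewrite !mul0r add0r subr0 mulr_ge0// !mulr_ge0// ltW.
  have PGgt : 0 < PG g.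
    rewrite lt_neqAle PG0 andbT; apply: contraTneq egt => h0.
    by rewrite /e -h0 mulr0 mul0r ltxx.
  have kgt : 0 < k g a z.
    rewrite lt_neqAle k0 andbT; apply: contraTneq egt => h0.
    by rewrite /e -h0 mulr0 ltxx.
  have Qgt : 0 < Q z by exact: kQ kgt.
  have Pgt : 0 < P ((a, z), phi g).
    rewrite /P (bigD1 g)//=; apply: ltr_pwDl => //.
    by apply: sumr_ge0 => g' _; exact: e0.
  have Pdgt : 0 < Pd (phi g).
    by rewrite /Pd (bigD1 g)//=; apply: ltr_pwDl => //; exact: sumr_ge0.
  have Pzdgt : 0 < Pzd z (phi g).
    by rewrite /Pzd (bigD1 a)//=; apply: ltr_pwDl => //; exact: sumr_ge0.
  have rhogt : 0 < rho ((a, z), phi g) by rewrite divr_gt0 ?mulr_gt0.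
  have kQgt : 0 < k g a z / Q z by rewrite divr_gt0.
  have := @ln_le_subr1 R (rho ((a, z), phi g) / (k g a z / Q z)) (divr_gt0 rhogt kQgt).
  rewrite [X in X <= _]ln_div ?posrE// => h.
  have := ler_wpM2l (ltW egt) h.
  have -> : e g a z * (rho (a, z, phi g) / (k g a z / Q z) - 1) =
    q g z * rho (a, z, phi g) - e g a z.
    by rewrite /e /q; field; rewrite !gt_eqF// ltr0n.
  lra.
apply: (le_trans step).
pose A1 := \sum_a \sum_z \sum_g q g z * rho ((a, z), phi g).
pose A2 := \sum_a \sum_z \sum_g e g a z.
have -> : \sum_a \sum_z \sum_g (e g a z * ln (k g a z / Q z) +
      (q g z * rho ((a, z), phi g) - e g a z)) =
  \sum_a \sum_z \sum_g e g a z * ln (k g a z / Q z) + (A1 - A2).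
  rewrite /A1 /A2 -sumrB -big_split; apply: eq_bigr => a _ /=.
  rewrite -sumrB -big_split; apply: eq_bigr => z _ /=.
  by rewrite -sumrB -big_split.
(* [A2] is a total mass. In [A1], summing [rho] over [a] cancels [Pzd z d] and leaves at most the
   mass of the product law of [Pd] and [Q]. *)
suff : A1 <= A2 by rewrite -subr_le0 => h; rewrite -[leRHS]addr0 lerD2l.
have -> : A2 = 1.
  rewrite /A2; transitivity (\sum_(a < m) (m%:R)^-1 * (1 : R)); last exact: sum_unif.
  apply: eq_bigr => a _; rewrite exchange_big mulr1 /=.
  under eq_bigr => g _.
    rewrite -mulr_sumr; case: (hk g a) => _ ->; rewrite mulr1; over.
  by rewrite -mulr_sumr; case: hPG => _ ->; rewrite mulr1.
have -> : A1 = \sum_z \sum_d \sum_a (m%:R)^-1 * Pd d * Q z * rho ((a, z), d).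
  rewrite /A1 exchange_big; apply: eq_bigr => z _ /=.
  rewrite [RHS]exchange_big; apply: eq_bigr => a _ /=.
  rewrite (partition_big phi predT)//=; apply: eq_bigr => d _.
  rewrite mulr_sumr !mulr_suml; apply: eq_bigr => g /eqP ->.
  by rewrite /q.
rewrite [leRHS](_ : 1 = \sum_z \sum_d Pd d * Q z); last first.
  rewrite exchange_big; under eq_bigr => d _.
    rewrite -mulr_sumr; case: hQ => _ ->; rewrite mulr1; over.
  by case: hPG => _ <-; rewrite (partition_big phi predT).
apply: ler_sum => z _; apply: ler_sum => d _.
have [Pdz|Pdnz] := eqVneq (Pd d) 0.
  by rewrite big1 ?Pdz ?mul0r// => a _; rewrite mulr0 !mul0r.
have [Pzdz|Pzdnz] := eqVneq (Pzd z d) 0.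
  rewrite big1 ?mulr_ge0// => a _.
  by rewrite /rho/= Pzdz mulr0 invr0 !mulr0.
under eq_bigr => a _.
  have -> : (m%:R)^-1 * Pd d * Q z * rho (a, z, d) =
     Pd d * Q z / Pzd z d * P ((a, z), d).
    by rewrite /rho/=; field; rewrite Pzdnz Pdnz pnatr_eq0 -lt0n m0.
  over.
by rewrite -mulr_sumr -/(Pzd z d) divfK.
Qed.

End CondMutInfo.

(** * Decoding error of a random codebook *)

Section OneShot.
Variables (R : realType) (T : finType) (p : T -> R) (M L : nat).
Hypothesis hp : is_pmf p.

Notation codebook := {ffun 'I_M.+1 * 'I_L.+1 -> T}.

(** The decoder depends on the codebook alone, so conditioning on it does not reveal the private
    index [l]. If no codeword passes, it answers [ord0]. *)
Definition decode (Y : finType) (test : T -> Y -> bool) (C : codebook) :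
    {ffun Y -> 'I_M.+1} :=
  [ffun y => odflt ord0 [pick a | [exists l, test (C (a, l)) y]]].

(** Union bound, pointwise in the output: an error requires that the sent codeword fails or that a
    codeword of another message passes. *)
Lemma decode_neq_le (Y : finType) (test : T -> Y -> bool) C a l y :
  ((decode test C y != a)%:R : R) <= (~~ test (C (a, l)) y)%:R +
    \sum_(a' | a' != a) \sum_l' (test (C (a', l')) y)%:R.
Proof.
have S0 (a' : 'I_M.+1) : 0 <= \sum_l' ((test (C (a', l')) y)%:R : R).
  exact: sumr_ge0.
case tC: (test (C (a, l)) y); last first.
  have : 0 <= \sum_(a' | a' != a) \sum_l' ((test (C (a', l')) y)%:R : R).
    exact: sumr_ge0.
  by case: (_ != a) => /=; lra.
rewrite add0r ffunE; case: pickP => [a' /existsP[l' tl']|/(_ a)/negbT]/=; last first.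
  by move/negP; case; apply/existsP; exists l.
have [_|a'a] := eqVneq a' a; first by rewrite sumr_ge0.
rewrite (bigD1 a')//= (bigD1 l')//= tl' -addrA lerDl addr_ge0 ?sumr_ge0//.
Qed.

(** A wrong codeword is independent of the sent one, so averaging it first, with [y] fixed, gives at
    most [b]; there are [M * L.+1] of them. By symmetry the bound holds for each message, hence for
    the maximal error. *)
Lemma random_coding_error (Y : finType) (w : T -> Y -> R)
    (test : T -> Y -> bool) (b : R) (a : 'I_M.+1) :
  (forall t, is_pmf (w t)) ->
  (forall y, \sum_t p t * (test t y)%:R <= b) ->
  \sum_(g : codebook * 'I_L.+1) (iid p g.1 * (L.+1%:R)^-1) *
     (1 - \sum_(y | decode test g.1 y == a) w (g.1 (a, g.2)) y) <=
  \sum_t \sum_y p t * w t y * (~~ test t y)%:R + M%:R * L.+1%:R * b.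
Proof.
move=> hw hb; have [p0 p1] := hp.
have w0 t y : 0 <= w t y by case: (hw t).
have iid0 (C : codebook) : 0 <= iid p C by case: (is_pmf_iid ('I_M.+1 * 'I_L.+1)%type hp).
set B := leRHS.
rewrite -(pair_bigA _ (fun C l => (iid p C * (L.+1%:R)^-1) *
     (1 - \sum_(y | decode test C y == a) w (C (a, l)) y)))/= exchange_big /=.
rewrite -[leRHS](@sum_unif R L.+1)//; apply: ler_sum => l _.
under eq_bigr do rewrite [iid _ _ * _]mulrC -mulrA.
rewrite -mulr_sumr ler_wpM2l ?invr_ge0//.
pose E1 (C : codebook) := \sum_y w (C (a, l)) y * (~~ test (C (a, l)) y)%:R.
pose E2 (C : codebook) (a' : 'I_M.+1) (l' : 'I_L.+1) :=
  \sum_y w (C (a, l)) y * (test (C (a', l')) y)%:R.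
apply: (@le_trans _ _ (\sum_C (iid p C * E1 C +
   \sum_(a' | a' != a) \sum_l' iid p C * E2 C a' l'))).
  apply: ler_sum => C _.
  under [X in _ <= _ + X]eq_bigr do rewrite -mulr_sumr.
  rewrite -mulr_sumr -mulrDr ler_wpM2l//.
  have -> : 1 - \sum_(y | decode test C y == a) w (C (a, l)) y =
      \sum_y w (C (a, l)) y * (decode test C y != a)%:R.
    rewrite -[X in X - _](proj2 (hw (C (a, l)))).
    rewrite (bigID (fun y => decode test C y == a))/= addrAC subrr add0r.
    rewrite big_mkcond; apply: eq_bigr => y _.
    by case: (_ == a); rewrite /= ?mulr1 ?mulr0.
  apply: (@le_trans _ _ (\sum_y (w (C (a, l)) y * (~~ test (C (a, l)) y)%:R +
     \sum_(a' | a' != a) \sum_l' w (C (a, l)) y * (test (C (a', l')) y)%:R))).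
    apply: ler_sum => y _.
    under eq_bigr do rewrite -mulr_sumr.
    rewrite -mulr_sumr -mulrDr ler_wpM2l//.
    exact: decode_neq_le.
  rewrite big_split lerD2l/= exchange_big/=; apply: ler_sum => a' _.
  by rewrite exchange_big.
rewrite big_split/= lerD//.
  rewrite (iid_marginal hp (a, l) (fun t => \sum_y w t y * (~~ test t y)%:R)).
  apply: ler_sum => t _; rewrite mulr_sumr; apply: ler_sum => y _.
  by rewrite mulrA.
rewrite exchange_big/=.
have -> : M%:R * L.+1%:R * b = \sum_(a' | a' != a) \sum_(l' < L.+1) b.
  rewrite !sumr_const card_ord cardC1 card_ord /=.
  by rewrite -mulrnA -[RHS]mulr_natl natrM mulrC [_ * L.+1%:R]mulrC mulrC.
apply: ler_sum => a' a'a; rewrite exchange_big; apply: ler_sum => l' _ /=.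
rewrite (iid_marginal2 hp (fun s t => \sum_y w s y * (test t y)%:R)); last first.
  by apply: contra_neq a'a => -[->].
apply: (@le_trans _ _ (\sum_s p s * b)); last by rewrite -mulr_suml p1 mul1r.
apply: ler_sum => s _.
under eq_bigr do rewrite -mulrA.
rewrite -mulr_sumr ler_wpM2l//.
under eq_bigr do rewrite mulr_sumr.
rewrite exchange_big/=.
apply: (@le_trans _ _ (\sum_y w s y * b)).
  apply: ler_sum => y _; under eq_bigr do rewrite mulrCA.
  by rewrite -mulr_sumr ler_wpM2l.
by rewrite -mulr_suml; case: (hw s) => _ ->; rewrite mul1r.
Qed.

End OneShot.


(** * Soft covering of the output law by a random codebook *)

Section SoftCovering.
Variables (R : realType) (T Z : finType) (p : T -> R) (v : T -> Z -> R).
Variables (M L : nat).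
Hypotheses (hp : is_pmf p) (hv : forall t, is_pmf (v t)).

Notation codebook := {ffun 'I_M.+1 * 'I_L.+1 -> T}.

Let Q (z : Z) : R := \sum_t p t * v t z.
Let vbar (C : codebook) a z : R := \sum_l (L.+1%:R)^-1 * v (C (a, l)) z.

Let p0 t : 0 <= p t. Proof. by case: hp. Qed.
Let v0 t z : 0 <= v t z. Proof. by case: (hv t). Qed.
Let Q0 z : 0 <= Q z. Proof. by apply: sumr_ge0 => t _; rewrite mulr_ge0. Qed.
Let L0 : 0 < (L.+1%:R : R). Proof. by rewrite ltr0Sn. Qed.

Let Q_gt0 t z : 0 < p t -> 0 < v t z -> 0 < Q z.
Proof.
move=> pt vt; rewrite /Q (bigD1 t)//=; apply: ltr_pwDl; first exact: mulr_gt0.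
by apply: sumr_ge0 => ? _; rewrite mulr_ge0.
Qed.

Let Q_pmf : is_pmf Q.
Proof.
split=> //; rewrite exchange_big/=.
under eq_bigr => t _ do rewrite -mulr_sumr (proj2 (hv t)) mulr1.
by case: hp.
Qed.

Let vbar_pmf C a : is_pmf (vbar C a).
Proof.
split=> [z|]; first by apply: sumr_ge0 => l _; rewrite mulr_ge0// invr_ge0 ltW.
rewrite exchange_big/=.
under eq_bigr => l _ do rewrite -mulr_sumr (proj2 (hv _)).
exact: sum_unif.
Qed.

Let iid_gt0 (C : codebook) i : 0 < iid p C -> 0 < p (C i).
Proof.
rewrite /iid (bigD1 i)//=; case: (ltgtP 0 (p (C i))) (p0 (C i)) => // <- _.
by rewrite mul0r ltxx.
Qed.

(** The fraction is the contribution of the codeword in use; the 1 accounts for the other [L]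
    codewords of the message. *)
Let c t z : R := 1 + v t z / (L.+1%:R * Q z).

Let c_ge1 t z : 1 <= c t z.
Proof. by rewrite lerDl divr_ge0// mulr_ge0// ltW. Qed.

Let c_gt0 t z : 0 < c t z. Proof. exact: lt_le_trans ltr01 (c_ge1 t z). Qed.

(* Conditionally on the codeword [t] in use, the others average to [Q], so the
   likelihood ratio [vbar / Q] has mean at most [c t z]. *)
Let cross_term (a : 'I_M.+1) (l : 'I_L.+1) :
  \sum_C iid p C *
    (\sum_z v (C (a, l)) z * (vbar C a z / Q z / c (C (a, l)) z)) <= 1.
Proof.
pose h s t z := v s z * ((L.+1%:R)^-1 * v t z / Q z / c s z).
have -> : \sum_C iid p C *
    (\sum_z v (C (a, l)) z * (vbar C a z / Q z / c (C (a, l)) z)) =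
  \sum_l' \sum_C iid p C * (\sum_z h (C (a, l)) (C (a, l')) z).
  rewrite [RHS]exchange_big/=; apply: eq_bigr => C _.
  rewrite -mulr_sumr exchange_big/=; congr (_ * _); apply: eq_bigr => z _.
  by rewrite /vbar !mulr_suml mulr_sumr.
rewrite (bigD1 l)//= (iid_marginal hp (a, l) (fun t => \sum_z h t t z)).
have hoff l' : l' != l -> \sum_(C : codebook) iid p C *
     (\sum_z h (C (a, l)) (C (a, l')) z) <=
    \sum_s p s * \sum_z v s z * ((L.+1%:R)^-1 / c s z).
  move=> l'l; rewrite (iid_marginal2 hp (fun s t => \sum_z h s t z)); last first.
    by rewrite eq_sym; apply: contra_neq l'l => -[->].
  apply: ler_sum => s _; under eq_bigr do rewrite -mulrA.
  rewrite -mulr_sumr ler_wpM2l//.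
  under eq_bigr do rewrite mulr_sumr.
  rewrite exchange_big/=; apply: ler_sum => z _.
  have -> : \sum_t p t * h s t z = v s z * (L.+1%:R)^-1 / c s z * (Q z / Q z).
    rewrite {1}/Q mulr_suml mulr_sumr; apply: eq_bigr => t _.
    by rewrite /h; ring.
  rewrite [leRHS]mulrA -[leRHS]mulr1 ler_wpM2l//.
    by rewrite !mulr_ge0 ?invr_ge0// ltW.
  by have [->|/divff->] := eqVneq (Q z) 0; rewrite ?mul0r ?ler01.
apply: (@le_trans _ _ (\sum_t p t * (\sum_z h t t z) + L%:R *
   \sum_s p s * \sum_z v s z * ((L.+1%:R)^-1 / c s z))).
  rewrite lerD2l; apply: le_trans (ler_sum _ hoff) _.
  by rewrite sumr_const cardC1 card_ord -[_ *+ _]mulr_natl.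
rewrite mulr_sumr -big_split/= -[leRHS](proj2 hp); apply: ler_sum => t _.
rewrite mulrCA -mulrDr -[leRHS]mulr1 ler_wpM2l//.
rewrite -[leRHS](proj2 (hv t)) mulr_sumr -big_split/=; apply: ler_sum => z _.
rewrite /h [L%:R * _]mulrCA -mulrDr -[leRHS]mulr1 ler_wpM2l//.
rewrite mulrA -mulrDl ler_pdivrMr// mul1r /c.
have -> : (L.+1%:R)^-1 * v t z / Q z = v t z / (L.+1%:R * Q z).
  by rewrite invfM; ring.
(* The [L] other codewords contribute [L / L.+1 <= 1]. *)
by rewrite addrC lerD2r ler_pdivrMr// mul1r ler_nat.
Qed.

(** Jensen's inequality given the codeword in use, in tangent form: [ln x <= ln c + (x / c - 1)]
    with [x = vbar / Q], and [cross_term] makes the correction at most 0 on average. *)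
Let divergence_le (a : 'I_M.+1) :
  \sum_z \sum_C iid p C * vbar C a z * ln (vbar C a z / Q z) <=
  \sum_t \sum_z p t * v t z * ln (c t z).
Proof.
set B := leRHS.
have -> : \sum_z \sum_C iid p C * vbar C a z * ln (vbar C a z / Q z) =
  \sum_(l < L.+1) (L.+1%:R)^-1 *
    \sum_C \sum_z iid p C * v (C (a, l)) z * ln (vbar C a z / Q z).
  under [RHS]eq_bigr do rewrite mulr_sumr.
  rewrite exchange_big [RHS]exchange_big/=; apply: eq_bigr => C _.
  under [RHS]eq_bigr do rewrite mulr_sumr.
  rewrite [RHS]exchange_big/=; apply: eq_bigr => z _.
  rewrite {1}/vbar mulr_sumr mulr_suml; apply: eq_bigr => l _.
  by ring.
rewrite -[leRHS](@sum_unif R L.+1)//; apply: ler_sum => l _.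
rewrite ler_wpM2l ?invr_ge0//.
apply: (@le_trans _ _ (\sum_C (iid p C * (\sum_z v (C (a, l)) z * ln (c (C (a, l)) z)) +
   (iid p C * (\sum_z v (C (a, l)) z * (vbar C a z / Q z / c (C (a, l)) z)) -
    iid p C)))).
  apply: ler_sum => C _.
  have -> : iid p C * (\sum_z v (C (a, l)) z * ln (c (C (a, l)) z)) +
   (iid p C * (\sum_z v (C (a, l)) z * (vbar C a z / Q z / c (C (a, l)) z)) -
    iid p C) =
    \sum_z iid p C * v (C (a, l)) z *
      (ln (c (C (a, l)) z) + (vbar C a z / Q z / c (C (a, l)) z - 1)).
    rewrite -[X in _ - X]mulr1 -[X in _ - _ * X](proj2 (hv (C (a, l)))) -mulrBr -mulrDr.
    rewrite -sumrB -big_split/= mulr_sumr; apply: eq_bigr => z _.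
    by ring.
  apply: ler_sum => z _.
  have : 0 <= iid p C by case: (is_pmf_iid ('I_M.+1 * 'I_L.+1)%type hp).
  rewrite le_eqVlt => /orP[/eqP<-|Cgt]; first by rewrite !mul0r.
  have := v0 (C (a, l)) z; rewrite le_eqVlt => /orP[/eqP<-|vgt].
    by rewrite mulr0 !mul0r.
  apply: ler_wpM2l; first by rewrite mulr_ge0 ?ltW.
  have Qgt : 0 < Q z by apply: Q_gt0 vgt; exact: iid_gt0.
  have vbargt : 0 < vbar C a z.
    rewrite /vbar (bigD1 l)//=; apply: ltr_pwDl.
      by rewrite mulr_gt0 ?invr_gt0.
    by apply: sumr_ge0 => l' _; rewrite mulr_ge0// invr_ge0 ltW.
  have rgt : 0 < vbar C a z / Q z by rewrite divr_gt0.
  have := ln_le_subr1 (divr_gt0 rgt (c_gt0 (C (a, l)) z)).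
  by rewrite [X in X <= _]ln_div ?posrE// lerBlDl.
rewrite big_split/= sumrB (proj2 (is_pmf_iid _ hp)).
rewrite (iid_marginal hp (a, l) (fun t => \sum_z v t z * ln (c t z))).
have -> : \sum_t p t * (\sum_z v t z * ln (c t z)) = B.
  apply: eq_bigr => t _; rewrite mulr_sumr; apply: eq_bigr => z _.
  by rewrite mulrA.
by have := cross_term a l; lra.
Qed.

(** Summing out the private index first replaces the channel by [vbar]; then [condmutinfo_le] with
    reference law [Q] reduces the leakage to one divergence per message. *)
Lemma soft_covering (D : finType) (phi : codebook -> D) :
  condmutinfo (fun t : 'I_M.+1 * Z * D =>
    \sum_(g : codebook * 'I_L.+1 | phi g.1 == t.2)
      (M.+1%:R)^-1 * (iid p g.1 * (L.+1%:R)^-1) * v (g.1 (t.1.1, g.2)) t.1.2) <=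
  \sum_t \sum_z p t * v t z * ln (1 + v t z / (L.+1%:R * \sum_t' p t' * v t' z)).
Proof.
have -> : (fun t : 'I_M.+1 * Z * D =>
    \sum_(g : codebook * 'I_L.+1 | phi g.1 == t.2)
      (M.+1%:R)^-1 * (iid p g.1 * (L.+1%:R)^-1) * v (g.1 (t.1.1, g.2)) t.1.2) =
  (fun t => \sum_(C | phi C == t.2) (M.+1%:R)^-1 * iid p C * vbar C t.1.1 t.1.2).
  apply: funext => t.
  under eq_bigl do rewrite -[_ == _]andbT.
  rewrite -(pair_big (fun C => phi C == t.2) xpredT (fun C l => 
     (M.+1%:R)^-1 * (iid p C * (L.+1%:R)^-1) * v (C (t.1.1, l)) t.1.2))/=.
  apply: eq_bigr => C _; rewrite mulr_sumr; apply: eq_bigr => l _.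
  by rewrite !mulrA.
have vbarQ C a z : 0 < iid p C -> 0 < vbar C a z -> 0 < Q z.
  move=> Cgt; rewrite lt0r => /andP[vn _].
  have [l vl] : exists l, v (C (a, l)) z != 0.
    apply/existsP; apply: contra_neqT vn; rewrite negb_exists => /forallP h.
    by apply: big1 => l _; have := h l; rewrite negbK => /eqP ->; rewrite mulr0.
  apply: (@Q_gt0 (C (a, l))); first exact: iid_gt0.
  by rewrite lt0r vl v0.
apply: le_trans (@condmutinfo_le R _ Z D M.+1 (@iid R _ T p) phi vbar Q isT
  (is_pmf_iid _ hp) Q_pmf vbar_pmf vbarQ) _.
rewrite -[leRHS](@sum_unif R M.+1)//; apply: ler_sum => a _.
under eq_bigr => z _.
  under eq_bigr => C _ do rewrite -2!mulrA.
  rewrite -mulr_sumr.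
  under eq_bigr do rewrite mulrA.
  over.
rewrite -mulr_sumr; apply: ler_wpM2l; first by rewrite invr_ge0.
exact: divergence_le.
Qed.

End SoftCovering.


(** * Exponential moments of the information density *)

Section InfoDensity.
Variables (R : realType) (X Y : finType).
Implicit Types (P : X -> R) (w : X -> Y -> R).

Definition outdist P w y : R := \sum_x P x * w x y.
(** The exponential of the information density. Where the output has probability 0 the quotient is
    0, which is why [sum_lratio_le1] is only an inequality. *)
Definition lratio P w x y : R := w x y / outdist P w y.
Definition channel_info P w : R := \sum_x \sum_y P x * w x y * ln (lratio P w x y).

Lemma outdist_ge0 P w y : (forall x, 0 <= P x) -> (forall x y, 0 <= w x y) ->
  0 <= outdist P w y.
Proof. by move=> P0 w0; apply: sumr_ge0 => x _; rewrite mulr_ge0. Qed.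

Lemma lratio_ge0 P w x y : (forall x, 0 <= P x) -> (forall x y, 0 <= w x y) ->
  0 <= lratio P w x y.
Proof. by move=> P0 w0; rewrite divr_ge0// outdist_ge0. Qed.

Lemma sum_lratio_le1 P w y : \sum_x P x * lratio P w x y <= 1.
Proof.
under eq_bigr do rewrite mulrA.
rewrite -mulr_suml -/(outdist P w y).
by have [->|/divff->] := eqVneq (outdist P w y) 0; rewrite ?mul0r ?ler01.
Qed.

Variables (P : X -> R) (w : X -> Y -> R).
Hypotheses (hP : is_pmf P) (hw : forall x, is_pmf (w x)).

Let P0 x : 0 <= P x. Proof. by case: hP. Qed.
Let w0 x y : 0 <= w x y. Proof. by case: (hw x). Qed.

Lemma joint_le_outdist x y : P x * w x y <= outdist P w y.
Proof.
rewrite /outdist (bigD1 x)//= lerDl.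
by apply: sumr_ge0 => x' _; rewrite mulr_ge0.
Qed.

Lemma outdist_gt0 x y : 0 < P x -> 0 < w x y -> 0 < outdist P w y.
Proof. by move=> ? ?; apply: lt_le_trans (joint_le_outdist x y); rewrite mulr_gt0. Qed.

Lemma lratio_gt0 x y : 0 < P x -> 0 < w x y -> 0 < lratio P w x y.
Proof. by move=> Px wxy; rewrite divr_gt0// (outdist_gt0 Px). Qed.

Lemma pmf_le1 (T : finType) (p : T -> R) t : is_pmf p -> p t <= 1.
Proof. by move=> [p0 <-]; rewrite (bigD1 t)//= lerDl sumr_ge0. Qed.

Lemma sum_outdist : \sum_y outdist P w y = 1.
Proof.
rewrite exchange_big/=.
under eq_bigr => x _ do rewrite -mulr_sumr (proj2 (hw x)) mulr1.
by case: hP.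
Qed.

Lemma sum_joint : \sum_x \sum_y P x * w x y = 1.
Proof. by rewrite exchange_big -[RHS]sum_outdist. Qed.

Lemma mutinfo_lratioE (J : X * Y -> R) :
  (forall x y, J (x, y) = P x * w x y) ->
  mutinfo J = channel_info P w.
Proof.
move=> JE; rewrite /channel_info pair_bigA/=; apply: eq_bigr => -[x y] _ /=.
have -> : marg1 J x = P x.
  rewrite /marg1; under eq_bigr do rewrite JE.
  by rewrite -mulr_sumr (proj2 (hw x)) mulr1.
have -> : marg2 J y = outdist P w y.
  by rewrite /marg2; under eq_bigr do rewrite JE.
rewrite JE; case: eqP => [->|/eqP]; first by rewrite mul0r.
rewrite mulf_eq0 negb_or => /andP[Px _].
by rewrite /lratio -mulf_div divff// mul1r.
Qed.

(** Gibbs' inequality term by term: the lower bounds [P x * w x y - P x * outdist P w y] sum to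
    0. *)
Lemma channel_info_ge0 : 0 <= channel_info P w.
Proof.
rewrite [leLHS](_ : 0 = \sum_x \sum_y (P x * w x y - P x * outdist P w y)); last first.
  under eq_bigr => x _ do rewrite sumrB -[X in _ - X]mulr_sumr sum_outdist mulr1.
  by rewrite sumrB sum_joint (proj2 hP) subrr.
apply: ler_sum => x _; apply: ler_sum => y _.
have := P0 x; rewrite le_eqVlt => /orP[/eqP<-|Px]; first by rewrite !mul0r subrr.
have := w0 x y; rewrite le_eqVlt => /orP[/eqP<-|wxy].
  by rewrite mulr0 mul0r sub0r oppr_le0 mulr_ge0// outdist_ge0.
have o0 := outdist_gt0 Px wxy.
have := ln_le_subr1 (divr_gt0 o0 wxy).
rewrite -[_ / w x y]invf_div lnV ?posrE ?divr_gt0// -/(lratio P w x y) => h.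
have := ler_wpM2l (mulr_ge0 (P0 x) (w0 x y)) h.
have -> : P x * w x y * ((lratio P w x y)^-1 - 1) =
  P x * outdist P w y - P x * w x y.
  by rewrite /lratio; field; rewrite !gt_eqF.
lra.
Qed.

(* The constant does not depend on the channel, even though the information
   density is unbounded: a pair of density [i] has probability at most
   [exp (- |i|)]. *)
Lemma mgf_lratio t : `|t| <= 1 / 2 ->
  \sum_x \sum_y P x * w x y * expR (t * ln (lratio P w x y)) <=
  1 + t * channel_info P w + t ^+ 2 * (16 * #|X|%:R * #|Y|%:R).
Proof.
move=> ht.
have -> : 16 * #|X|%:R * #|Y|%:R = \sum_(x : X) \sum_(y : Y) (16 : R).
  rewrite !sumr_const -mulrnA -[RHS]mulr_natr natrM.
  by rewrite -mulrA [#|X|%:R * _]mulrC.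
rewrite -[X in X + _ + _]sum_joint 2!mulr_sumr -!big_split/=.
apply: ler_sum => x _; rewrite 2!mulr_sumr -!big_split/=; apply: ler_sum => y _.
set i := ln _; set J := P x * w x y.
have J0 : 0 <= J by rewrite mulr_ge0.
have Ji : J <= expR (- `|i|).
  have := P0 x; rewrite le_eqVlt => /orP[/eqP PE|Px]; first by rewrite /J -PE mul0r expR_ge0.
  have := w0 x y; rewrite le_eqVlt => /orP[/eqP wE|wxy].
    by rewrite /J -wE mulr0 expR_ge0.
  have o0 := outdist_gt0 Px wxy; have r0 := lratio_gt0 Px wxy.
  have Jw : J <= w x y by rewrite ler_piMl// pmf_le1.
  have w1 : w x y <= 1 by exact: pmf_le1.
  have o1 : outdist P w y <= 1.
    by rewrite -sum_outdist (bigD1 y)//= lerDl sumr_ge0// => ? _; rewrite outdist_ge0.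
  have Jo := joint_le_outdist x y.
  have [i0|i0] := leP 0 i.
    rewrite ger0_norm// expRN lnK ?posrE// invf_div ler_pdivlMr//.
    by apply: le_trans Jo; rewrite ler_piMr.
  rewrite ltr0_norm// opprK lnK ?posrE// ler_pdivlMr//.
  by apply: le_trans Jw; rewrite ler_piMr.
have h1 := ler_wpM2l J0 (expR_le_taylor2 (t * i)).
suff h2 : J * ((t * i) ^+ 2 * expR `|t * i|) <= t ^+ 2 * 16 by lra.
rewrite exprMn mulrCA -mulrA ler_wpM2l ?sqr_ge0//.
have h3 : expR `|t * i| <= expR (`|i| / 2).
  by rewrite ler_expR normrM; have := normr_ge0 i; nra.
have h4 := sqr_le_expR_half (normr_ge0 i).
rewrite real_normK ?num_real// in h4.
have h5 : J * expR `|t * i| <= expR (- `|i|) * expR (`|i| / 2).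
  by rewrite ler_pM// expR_ge0.
(* Of the decay [exp (- |i|)], one half absorbs [i ^+ 2] at the cost of the factor 16, the other
   half absorbs [exp |t * i|], as [|t| <= 1 / 2]. *)
apply: (@le_trans _ _ (16 * expR (`|i| / 2) * (expR (- `|i|) * expR (`|i| / 2)))).
  by apply: ler_pM; rewrite ?sqr_ge0 // mulr_ge0 ?expR_ge0.
rewrite -mulrA -2!expRD (_ : _ + _ = 0) ?expR0 ?mulr1//.
by lra.
Qed.

End InfoDensity.

Lemma prodr_gt0_factor (R : realType) (I : finType) (F : I -> R) i :
  (forall j, 0 <= F j) -> 0 < \prod_j F j -> 0 < F i.
Proof.
move=> F0; rewrite (bigD1 i)//= => h; rewrite lt0r F0 andbT.
by apply: contraTneq h => ->; rewrite mul0r ltxx.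
Qed.

(** * Exponential decay of the leakage *)

Section Secrecy.
Variables (R : realType) (N : nat) (S X Z : finType) (P : X -> R)
  (V : S -> X -> Z -> R).
Hypotheses (hP : is_pmf P) (hV : channel V).

Let P0 x : 0 <= P x. Proof. by case: hP. Qed.
Let V0 s x z : 0 <= V s x z. Proof. by case: (hV s x). Qed.

(** [ln1DexpR_le] is applied with [y] the total information density minus [ln lam]. The resulting
    moment factorizes over the letters, and [mgf_lratio] bounds each factor for its own state, so
    only the sum of the informations enters. *)
Lemma divergence_chernoff (sN : {ffun 'I_N -> S}) (lam t I : R) :
  0 < lam -> 0 < t <= 1 / 2 ->
  \sum_i channel_info P (V (sN i)) <= I ->
  \sum_f \sum_g iid P f * chanN V sN f g *
     ln (1 + chanN V sN f g / (lam * \sum_f' iid P f' * chanN V sN f' g)) <=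
  expR (t * (I + N%:R * (t * (16 * #|X|%:R * #|Z|%:R)) - ln lam)) / t.
Proof.
move=> lam0 /andP[t0 t1] hI.
set K := 16 * #|X|%:R * #|Z|%:R.
pose F i x z := P x * V (sN i) x z * expR (t * ln (lratio P (V (sN i)) x z)).
apply: (@le_trans _ _ (\sum_(f : {ffun 'I_N -> X}) \sum_(g : {ffun 'I_N -> Z})
   expR (- (t * ln lam)) / t * \prod_i F i (f i) (g i))).
  apply: ler_sum => f _; apply: ler_sum => g _.
  have -> : \sum_f' iid P f' * chanN V sN f' g = \prod_i outdist P (V (sN i)) (g i).
    by rewrite (iid_prodE _ (fun i x => V (sN i) x (g i))).
  rewrite /F big_split/= -/(iid P f) big_split/= -/(iid P f) -/(chanN V sN f g).
  have i0 : 0 <= iid P f by exact: prodr_ge0.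
  have c0 : 0 <= chanN V sN f g by exact: prodr_ge0.
  have := i0; rewrite le_eqVlt => /orP[/eqP<-|ipos]; first by rewrite !mul0r mulr0.
  have := c0; rewrite le_eqVlt => /orP[/eqP<-|cpos].
    by rewrite mulr0 !mul0r mulr0.
  have rpos i : 0 < lratio P (V (sN i)) (f i) (g i).
    apply: (lratio_gt0 hP (hV (sN i))); first exact: prodr_gt0_factor ipos.
    by apply: (@prodr_gt0_factor _ _ (fun i => V (sN i) (f i) (g i))).
  have opos : 0 < \prod_i outdist P (V (sN i)) (g i).
    apply: prodr_gt0 => i _; apply: (@outdist_gt0 _ _ _ P (V (sN i)) hP (hV (sN i)) (f i)).
      exact: prodr_gt0_factor ipos.
    by apply: (@prodr_gt0_factor _ _ (fun i => V (sN i) (f i) (g i))).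
  have -> : chanN V sN f g / (lam * \prod_i outdist P (V (sN i)) (g i)) =
     expR (\sum_i ln (lratio P (V (sN i)) (f i) (g i)) - ln lam).
    rewrite expRB lnK ?posrE// expR_sum.
    under [in RHS]eq_bigr => i _ do rewrite lnK ?posrE//.
    rewrite /lratio big_split/= prodfV -/(chanN V sN f g).
    by field; rewrite !gt_eqF.
  rewrite [leRHS]mulrCA ler_wpM2l ?mulr_ge0//.
  have ht : 0 < t <= 1 by rewrite t0; lra.
  apply: le_trans (ln1DexpR_le _ ht) _.
  rewrite -expR_sum -mulr_sumr mulrAC -expRD ler_pM2r ?invr_gt0// ler_expR.
  by lra.
under eq_bigr do rewrite -mulr_sumr.
rewrite -mulr_sumr sum2_prod_ffun mulrAC ler_pM2r ?invr_gt0//.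
apply: (@le_trans _ _ (expR (- (t * ln lam)) *
   \prod_(i < N) expR (t * channel_info P (V (sN i)) + t ^+ 2 * K))).
  rewrite ler_wpM2l ?expR_ge0//; apply: ler_prod => i _; apply/andP; split.
    apply: sumr_ge0 => x _; apply: sumr_ge0 => z _.
    by rewrite !mulr_ge0// expR_ge0.
  apply: le_trans (mgf_lratio hP (hV (sN i)) _) _; first by rewrite gtr0_norm.
  by apply: le_trans (expR_ge1Dx _); rewrite addrA.
rewrite -expR_sum -expRD ler_expR big_split/= -mulr_sumr sumr_const card_ord.
rewrite -[_ *+ N]mulr_natl.
have := ler_wpM2l (ltW t0) hI; lra.
Qed.

End Secrecy.

(** * Universal decoding over state types *)

Section Decoding.
Variables (R : realType) (S : finType).

(** State types are indexed by vectors of counts, a finite type with [(N+1)^|S|] elements that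
    contains every true type; a general vector need not sum to [N]. *)
Definition emp (N : nat) (k : {ffun S -> 'I_N.+1}) (s : S) : R := (k s)%:R / N%:R.

Definition counts (N : nat) (sN : {ffun 'I_N -> S}) : {ffun S -> 'I_N.+1} :=
  [ffun s => inord #|[pred i | sN i == s]|].

Lemma sum_emp (N : nat) (sN : {ffun 'I_N -> S}) (g : S -> R) : (0 < N)%N ->
  \sum_i g (sN i) = N%:R * \sum_s emp (counts sN) s * g s.
Proof.
move=> N0; rewrite (partition_big sN predT)//= mulr_sumr; apply: eq_bigr => s _.
rewrite /emp ffunE inordK; last by rewrite ltnS -[X in (_ <= X)%N](card_ord N) max_card.
rewrite mulrCA mulrA divfK ?pnatr_eq0 -?lt0n// mulr_natl -sumr_const.
by apply: eq_big => [i|i /eqP ->].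
Qed.

Lemma emp_pmf (N : nat) (sN : {ffun 'I_N -> S}) : (0 < N)%N ->
  is_pmf (emp (counts sN)).
Proof.
move=> N0; split=> [s|]; first by rewrite divr_ge0.
have := @sum_emp N sN (fun=> 1) N0.
rewrite sumr_const card_ord -[LHS]mulr1.
under eq_bigr do rewrite mulr1.
by move=> /mulfI; rewrite pnatr_eq0 -lt0n N0 => ->.
Qed.

Lemma emp_gt0 (N : nat) (sN : {ffun 'I_N -> S}) i : (0 < N)%N ->
  0 < emp (counts sN) (sN i).
Proof.
move=> N0; rewrite divr_gt0 ?ltr0n// /counts ffunE inordK.
  by apply/card_gt0P; exists i; rewrite inE.
by rewrite ltnS -[X in (_ <= X)%N](card_ord N) max_card.
Qed.

Variables (X Y : finType) (P : X -> R) (W : S -> X -> Y -> R).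
Hypotheses (hP : is_pmf P) (hW : channel W).

Let P0 x : 0 <= P x. Proof. by case: hP. Qed.
Let W0 s x y : 0 <= W s x y. Proof. by case: (hW s x). Qed.

Lemma avg_chan_pmf (q : S -> R) x : is_pmf q -> is_pmf (avg_chan W q x).
Proof.
move=> [q0 q1]; split=> [y|]; first by apply: sumr_ge0 => s _; rewrite mulr_ge0.
rewrite exchange_big/=.
by under eq_bigr => s _ do rewrite -mulr_sumr (proj2 (hW s x)) mulr1.
Qed.

(* Threshold decoding against every empirical state distribution at once:
   there are only polynomially many of them. *)
Definition typetest (N : nat) (tau : R) (f : {ffun 'I_N -> X})
    (g : {ffun 'I_N -> Y}) : bool :=
  [exists k : {ffun S -> 'I_N.+1},
    expR (N%:R * tau) <= \prod_i lratio P (avg_chan W (emp k)) (f i) (g i)].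

(** For a fixed output word and fixed [k], the product of ratios has iid mean at most 1 by
    [sum_lratio_le1], so Markov's inequality gives [exp (- N * tau)]; a union bound over [k]
    follows. *)
Lemma typetest_false_alarm (N : nat) (tau : R) (g : {ffun 'I_N -> Y}) :
  \sum_f iid P f * (typetest tau f g)%:R <=
  N.+1%:R ^+ #|S| * expR (- (N%:R * tau)).
Proof.
have iid0 (f : {ffun 'I_N -> X}) : 0 <= iid P f by exact: prodr_ge0.
have r0 k x y : 0 <= lratio P (avg_chan W (@emp N k)) x y.
  apply: lratio_ge0 => // x' y'; apply: sumr_ge0 => s _.
  by rewrite mulr_ge0// divr_ge0.
apply: (@le_trans _ _ (\sum_f \sum_(k : {ffun S -> 'I_N.+1}) expR (- (N%:R * tau)) *
   (iid P f * \prod_i lratio P (avg_chan W (emp k)) (f i) (g i)))).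
  apply: ler_sum => f _.
  have pos k : 0 <= expR (- (N%:R * tau)) *
     (iid P f * \prod_i lratio P (avg_chan W (@emp N k)) (f i) (g i)).
    by rewrite mulr_ge0 ?expR_ge0// mulr_ge0// prodr_ge0.
  case: (boolP (typetest tau f g)) => [/existsP[k hk]|_]; last first.
    by rewrite mulr0 sumr_ge0.
  rewrite mulr1 (bigD1 k)//= -[leLHS]addr0 lerD ?sumr_ge0// mulrCA.
  rewrite ler_peMr// expRN -ler_pdivrMl ?invr_gt0 ?expR_gt0// invrK mulr1.
  exact: hk.
rewrite exchange_big/=.
have -> : N.+1%:R ^+ #|S| * expR (- (N%:R * tau)) =
    \sum_(k : {ffun S -> 'I_N.+1}) expR (- (N%:R * tau)).
  by rewrite sumr_const card_ffun card_ord -[RHS]mulr_natl natrX.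
apply: ler_sum => k _; rewrite -mulr_sumr ler_piMr ?expR_ge0//.
rewrite (iid_prodE _ (fun i x => lratio P (avg_chan W (emp k)) x (g i))).
apply: prodr_ile1 => i _; rewrite sum_lratio_le1 andbT sumr_ge0// => x _.
by rewrite mulr_ge0.
Qed.

(** Chernoff bound with exponent [- t] for the test of the true type. All letters share the density
    of [Wq], so after [1 + x <= expR x] the exponent is linear in the channels [W (sN i)], which
    average to [Wq]; [mgf_lratio] then applies to [Wq] itself. *)
Lemma typetest_miss (N : nat) (sN : {ffun 'I_N -> S}) (tau t : R) :
  (0 < N)%N -> 0 < t <= 1 / 2 ->
  \sum_f \sum_g iid P f * chanN W sN f g * (~~ typetest tau f g)%:R <=
  expR (t * N%:R * (tau + t * (16 * #|X|%:R * #|Y|%:R) -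
    channel_info P (avg_chan W (emp (counts sN))))).
Proof.
move=> N0 /andP[t0 t1].
set q := emp (counts sN); set Wq := avg_chan W q.
set I := channel_info P Wq; set K := 16 * _ * _.
have hq : is_pmf q by exact: emp_pmf.
have hWq x : is_pmf (Wq x) by exact: avg_chan_pmf.
pose e x y := expR (- t * ln (lratio P Wq x y)).
pose F i x y := P x * W (sN i) x y * e x y.
apply: (@le_trans _ _ (\sum_(f : {ffun 'I_N -> X}) \sum_(g : {ffun 'I_N -> Y})
   expR (t * (N%:R * tau)) * \prod_i F i (f i) (g i))).
  apply: ler_sum => f _; apply: ler_sum => g _.
  rewrite /F big_split/= big_split/= -/(iid P f) -/(chanN W sN f g) mulrCA.
  have : 0 <= iid P f by exact: prodr_ge0.
  rewrite le_eqVlt => /orP[/eqP<-|ipos]; first by rewrite !mul0r.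
  have : 0 <= chanN W sN f g by exact: prodr_ge0.
  rewrite le_eqVlt => /orP[/eqP<-|cpos]; first by rewrite mulr0 !mul0r.
  have rpos i : 0 < lratio P Wq (f i) (g i).
    apply: lratio_gt0 => //; first exact: prodr_gt0_factor ipos.
    rewrite /Wq /avg_chan (bigD1 (sN i))//=; apply: ltr_pwDl.
      rewrite mulr_gt0 ?emp_gt0//.
      exact: (@prodr_gt0_factor _ _ (fun i => W (sN i) (f i) (g i))).
    by apply: sumr_ge0 => s _; rewrite mulr_ge0//; case: hq.
  apply: ler_wpM2l; first by rewrite mulr_ge0 ?ltW.
  case: (boolP (typetest tau f g)) => ht.
    by rewrite mulr_ge0 ?expR_ge0 ?prodr_ge0// => i _; exact: expR_ge0.
  rewrite -expR_sum -expRD -mulr_sumr.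
  have : \sum_i ln (lratio P Wq (f i) (g i)) <= N%:R * tau.
    rewrite -ler_expR expR_sum ltW//.
    under eq_bigr => i _ do rewrite lnK ?posrE//.
    rewrite ltNge; apply: contra ht => ht.
    by apply/existsP; exists (counts sN).
  move=> /(ler_wpM2l (ltW t0)) h; apply: le_trans (expR_ge1Dx _).
  rewrite mulr1n; lra.
under eq_bigr do rewrite -mulr_sumr.
rewrite -mulr_sumr sum2_prod_ffun.
pose E s := \sum_x \sum_y P x * W s x y * e x y.
apply: (@le_trans _ _ (expR (t * (N%:R * tau)) * \prod_(i < N) expR (E (sN i) - 1))).
  rewrite ler_wpM2l ?expR_ge0//; apply: ler_prod => i _; apply/andP; split.
    apply: sumr_ge0 => x _; apply: sumr_ge0 => y _.
    by rewrite !mulr_ge0// expR_ge0.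
  by apply: le_trans (expR_ge1Dx _); rewrite addrC subrK.
rewrite -expR_sum -expRD ler_expR (sum_emp sN (fun s => E s - 1)) //.
have -> : \sum_s emp (counts sN) s * (E s - 1) =
    \sum_x \sum_y P x * Wq x y * e x y - 1.
  under eq_bigr do rewrite mulrBr mulr1.
  rewrite sumrB (proj2 hq); congr (_ - _).
  under eq_bigr do rewrite mulr_sumr.
  rewrite exchange_big/=; apply: eq_bigr => x _.
  under eq_bigr do rewrite mulr_sumr.
  rewrite exchange_big/=; apply: eq_bigr => y _.
  rewrite /Wq /avg_chan mulr_sumr mulr_suml; apply: eq_bigr => s _.
  by rewrite /q; ring.
have := @mgf_lratio _ _ _ _ _ hP hWq (- t).
rewrite normrN gtr0_norm// sqrrN -/I -/K => /(_ t1) h.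
have h2 : \sum_x \sum_y P x * Wq x y * e x y - 1 <= t * (t * K - I).
  by rewrite /e; lra.
have := ler_wpM2l (ler0n R N) h2; lra.
Qed.

End Decoding.


(** * Channel prefixing *)

Section Prefix.
Variables (R : realType) (U X : finType) (k : U -> X -> R).
Hypothesis hk : forall u, is_pmf (k u).

Definition prefixed (S Y : finType) (W : S -> X -> Y -> R) s u y : R :=
  \sum_x k u x * W s x y.

Lemma prefixed_channel (S Y : finType) (W : S -> X -> Y -> R) :
  channel W -> channel (prefixed W).
Proof.
move=> hW s u; split=> [y|].
  apply: sumr_ge0 => x _; apply: mulr_ge0; first by case: (hk u).
  by case: (hW s x).
rewrite exchange_big/=.
under eq_bigr => x _ do rewrite -mulr_sumr (proj2 (hW s x)) mulr1.
by case: (hk u).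
Qed.

(* An independent random map [U -> X] per letter: drawing the whole map rather
   than one symbol keeps the encoder randomness independent of the message. *)
Definition mapprob (N : nat) (xi : {ffun 'I_N -> {ffun U -> X}}) : R :=
  iid (fun h : {ffun U -> X} => \prod_u k u (h u)) xi.

Lemma mapprob_pmf N : is_pmf (@mapprob N).
Proof.
apply: is_pmf_iid; split=> [h|]; first by apply: prodr_ge0 => u _; case: (hk u).
by rewrite sum_prod_ffun big1// => u _; case: (hk u).
Qed.

Lemma chanN_prefixed (S Y : finType) (W : S -> X -> Y -> R) N
    (sN : {ffun 'I_N -> S}) (u : {ffun 'I_N -> U}) (y : {ffun 'I_N -> Y}) :
  \sum_xi mapprob xi * chanN W sN [ffun i => xi i (u i)] y =
  chanN (prefixed W) sN u y.
Proof.
transitivity (\sum_(xi : {ffun 'I_N -> {ffun U -> X}}) mapprob xi *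
    \prod_i W (sN i) (xi i (u i)) (y i)).
  apply: eq_bigr => xi _; congr (_ * _).
  by apply: eq_bigr => i _; rewrite ffunE.
rewrite (iid_prodE _ (fun i (h : {ffun U -> X}) => W (sN i) (h (u i)) (y i))).
apply: eq_bigr => i _.
exact: (indep_marginal (u i) (fun x => W (sN i) x (y i)) hk).
Qed.

(** The random maps are added to the encoder only. Error probability and joint law with the decoder
    are affine in the channel, so averaging over the maps reproduces exactly those of the prefixed
    channels. *)
Lemma achievable_prefixed (S Y Z : finType) (W : S -> X -> Y -> R)
    (V : S -> X -> Z -> R) (c : S -> R) (Lam Rt : R) :
  achievable_rc (prefixed W) (prefixed V) c Lam Rt -> achievable_rc W V c Lam Rt.
Proof.
move=> h eps eps0; have [N0 hN0] := h _ eps0; exists N0 => N /hN0.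
move=> [m [G [PG [f [phi [m0 hPG hrate herr hsec]]]]]].
have [PG0 PG1] := hPG; have [nu0 nu1] := mapprob_pmf N.
exists m, (G * {ffun 'I_N -> {ffun U -> X}})%type.
exists (fun g => PG g.1 * mapprob g.2).
exists (fun (g : G * {ffun 'I_N -> {ffun U -> X}}) a => [ffun i => g.2 i (f g.1 a i)]).
exists (fun g => phi g.1).
split=> //.
- split=> [g|]; first by rewrite mulr_ge0.
  rewrite -(pair_bigA _ (fun g xi => PG g * mapprob xi))/=.
  by under eq_bigr do rewrite -mulr_sumr nu1 mulr1.
- move=> sN hs a; rewrite (_ : rc_err _ _ _ _ _ _ = rc_err (prefixed W) PG f phi sN a).
    exact: herr.
  rewrite /rc_err -(pair_bigA _ (fun g xi => PG g * mapprob xi *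
    (1 - \sum_(y | phi g y == a) chanN W sN [ffun i => xi i (f g a i)] y)))/=.
  apply: eq_bigr => g _.
  under eq_bigr do rewrite -mulrA mulrBr mulr1.
  rewrite -mulr_sumr sumrB nu1; congr (_ * (_ - _)).
  under [LHS]eq_bigr do rewrite mulr_sumr.
  by rewrite exchange_big; apply: eq_bigr => y _; exact: chanN_prefixed.
- move=> sN hs.
  rewrite (_ : rc_joint_MZPhi _ _ _ _ _ = rc_joint_MZPhi (prefixed V) PG f phi sN).
    exact: hsec.
  apply: funext => t; rewrite /rc_joint_MZPhi.
  under eq_bigl do rewrite -[_ == _]andbT.
  rewrite -(pair_big (fun g => phi g == t.2) xpredT (fun g xi =>
    m%:R^-1 * (PG g * mapprob xi) *
      chanN V sN [ffun i => xi i (f g t.1.1 i)] t.1.2))/=.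
  apply: eq_bigr => g _; rewrite -chanN_prefixed mulr_sumr.
  by apply: eq_bigr => xi _; rewrite !mulrA.
Qed.

End Prefix.

(** * Assembling the random code *)

Section Achievability.
Variables (R : realType) (S X Y Z : finType) (P : X -> R).
Variables (W : S -> X -> Y -> R) (V : S -> X -> Z -> R) (c : S -> R) (Lam Rt : R).
Hypotheses (hP : is_pmf P) (hW : channel W) (hV : channel V).

Lemma emp_in_PSL N (sN : {ffun 'I_N -> S}) : (0 < N)%N -> costN c sN <= Lam ->
  in_PSL c Lam (emp R (counts sN)).
Proof.
move=> N0 hc; split; first exact: emp_pmf.
apply: le_trans hc; rewrite /costN (sum_emp sN c)// mulKf ?pnatr_eq0 -?lt0n//.
by rewrite /cost_pmf; under eq_bigr do rewrite mulrC.
Qed.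

(** A single level [A] separates the requirements: [L] has rate just above [A] for secrecy, and the
    total rate of [M] and [L] stays below the information of every admissible [W_q]. *)
Lemma achievable_of_level (A : R) : 0 <= A ->
  (forall q, in_PSL c Lam q -> \sum_s q s * channel_info P (V s) <= A) ->
  (forall q, in_PSL c Lam q -> Rt + A <= channel_info P (avg_chan W q)) ->
  achievable_rc W V c Lam Rt.
Proof.
move=> A0 hA hI eps eps0.
pose K1 : R := 16 * #|X|%:R * #|Y|%:R; pose K2 : R := 16 * #|X|%:R * #|Z|%:R.
have K10 : 0 <= K1 by rewrite !mulr_ge0. have K20 : 0 <= K2 by rewrite !mulr_ge0.
pose del := eps / 8; have del0 : 0 < del by rewrite divr_gt0.
(* [mgf_lratio] needs [t <= 1 / 2]; the second bound keeps the quadratic terms [t * K1] and [t * K2]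
   below [del / 2], so a margin [del / 2] survives in both exponents. *)
pose t := Num.min (1 / 2) (del / (2 * (K1 + K2 + 1))).
have t0 : 0 < t.
  rewrite lt_min; apply/andP; split; first by lra.
  by rewrite divr_gt0//; lra.
have t1 : t <= 1 / 2 by rewrite ge_min lexx.
have t01 : 0 < t <= 1 / 2 by rewrite t0.
have tK : t * (K1 + K2 + 1) <= del / 2.
  have : t <= del / (2 * (K1 + K2 + 1)) by rewrite ge_min lexx orbT.
  rewrite ler_pdivlMr; first by lra.
  by lra.
have tK1 : t * K1 <= del / 2 by have := mulr_ge0 (ltW t0) K20; lra.
have tK2 : t * K2 <= del / 2 by have := mulr_ge0 (ltW t0) K10; lra.
pose a := t * (del / 2).
have a0 : 0 < a by rewrite mulr_gt0 ?divr_gt0.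
have ale : a <= eps / 4 by rewrite /a /del; nra.
(* The error will be at most [3 * D], and the leakage bound carries a factor [1 / t]. *)
have e0 : 0 < Num.min (eps / 3) (eps * t) by rewrite lt_min divr_gt0 ?mulr_gt0.
have [N0 hN0] := poly_expR_small #|S| a0 e0.
exists N0.+1 => N hN.
have Npos : (0 < N)%N by exact: leq_trans hN.
have NR0 : 0 < (N%:R : R) by rewrite ltr0n.
have := hN0 N (ltnW hN); rewrite lt_min; set D := _ * expR _ => /andP[D1 D2].
have Dexp : expR (- (a * N%:R)) <= D.
  rewrite ler_peMl ?expR_ge0//.
  by apply: exprn_ege1; rewrite ler1n.
(* The total rate [rho + A + del] lies [eps / 4] below [tau], which lies [del] below the guaranteed
   information [Rt + A]. *)
pose rho := Rt - eps / 2; pose tau := A + Rt - del.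
pose M := Num.trunc (expR (N%:R * rho)).
pose L := Num.trunc (expR (N%:R * (A + del))).
have Mle : M%:R <= expR (N%:R * rho) by rewrite truncn_le expR_ge0.
have Mgt : expR (N%:R * rho) < M.+1%:R by exact: truncnS_gt.
have Lgt : expR (N%:R * (A + del)) < L.+1%:R by exact: truncnS_gt.
(* Since [0 <= A], the exponential is at least 1 and rounding up costs at most a factor 2. *)
have Lle : L.+1%:R <= 2 * expR (N%:R * (A + del)).
  have h1 : L%:R <= expR (N%:R * (A + del)) by rewrite truncn_le expR_ge0.
  have h2 := expR_ge1Dx (N%:R * (A + del)).
  have h3 : 0 <= N%:R * (A + del) by rewrite mulr_ge0 ?addr_ge0// ltW.
  by rewrite -natr1; lra.
pose test := @typetest R S X Y P W N tau.
pose G := ({ffun 'I_M.+1 * 'I_L.+1 -> {ffun 'I_N -> X}} * 'I_L.+1)%type.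
exists M.+1, G.
exists (fun g : G => iid (@iid R 'I_N X P) g.1 * (L.+1%:R)^-1).
exists (fun (g : G) msg => g.1 (msg, g.2)), (fun g => decode test g.1).
have hPN : is_pmf (@iid R 'I_N X P) by exact: is_pmf_iid.
have [iid0 iid1] := @is_pmf_iid R ('I_M.+1 * 'I_L.+1)%type _ _ hPN.
split=> //.
- split=> [g|]; first by rewrite mulr_ge0// invr_ge0.
  rewrite -(pair_bigA _ (fun C (l : 'I_L.+1) =>
    iid (@iid R 'I_N X P) C * (L.+1%:R)^-1))/=.
  rewrite -[RHS]iid1; apply: eq_bigr => C _.
  by under eq_bigr do rewrite mulrC; rewrite sum_unif.
- apply: (@lt_trans _ _ rho); first by rewrite /rho; lra.
  by rewrite ltr_pdivlMr// -ltr_expR lnK ?posrE// mulrC.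
- move=> sN hs msg; have hq := emp_in_PSL Npos hs.
  apply: (@le_lt_trans _ _ (3 * D)); last by lra.
  apply: le_trans (@random_coding_error R _ _ M L hPN _ (chanN W sN) test
    (N.+1%:R ^+ #|S| * expR (- (N%:R * tau))) msg _ _) _.
  + by move=> x; exact: is_pmf_chanN.
  + by move=> y; exact: typetest_false_alarm.
  have miss : \sum_f \sum_g iid P f * chanN W sN f g * (~~ test f g)%:R <= D.
    apply: le_trans (typetest_miss hP hW sN tau Npos t01) _.
    apply: le_trans Dexp; rewrite ler_expR -/K1.
    have h := hI _ hq.
    have : tau + t * K1 - channel_info P (avg_chan W (emp R (counts sN))) <= - (del / 2).
      by rewrite /tau; lra.
    move=> /(ler_wpM2l (mulr_ge0 (ltW t0) (ltW NR0))); rewrite /a; lra.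
  suff confusion : M%:R * L.+1%:R * (N.+1%:R ^+ #|S| * expR (- (N%:R * tau))) <= 2 * D.
    by rewrite (_ : 3 * D = D + 2 * D) ?lerD//; lra.
  apply: (@le_trans _ _ (expR (N%:R * rho) * (2 * expR (N%:R * (A + del))) *
    (N.+1%:R ^+ #|S| * expR (- (N%:R * tau))))).
    rewrite ler_wpM2r ?mulr_ge0 ?expR_ge0 ?exprn_ge0//.
    by rewrite ler_pM.
  rewrite (_ : _ * _ = 2 * (N.+1%:R ^+ #|S| *
    (expR (N%:R * rho) * expR (N%:R * (A + del)) * expR (- (N%:R * tau))))); last by ring.
  rewrite ler_wpM2l// /D ler_wpM2l ?exprn_ge0// -2!expRD ler_expR.
  have := ler_wpM2l (ltW NR0) ale; rewrite /rho /tau /del; lra.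
- move=> sN hs; have hq := emp_in_PSL Npos hs.
  have hsc := @soft_covering R _ _ (iid P) (chanN V sN) M L hPN
    (fun x => is_pmf_chanN sN x hV) _ (decode test).
  refine (le_lt_trans hsc _).
  have hNA : \sum_i channel_info P (V (sN i)) <= N%:R * A.
    rewrite (sum_emp sN (fun s => channel_info P (V s)))// ler_wpM2l//.
    exact: hA.
  apply: le_lt_trans (divergence_chernoff hP hV (ltr0Sn _ _) t01 hNA) _.
  rewrite ltr_pdivrMr//; apply: le_lt_trans D2; apply: le_trans Dexp.
  rewrite ler_expR -/K2.
  have hL : N%:R * (A + del) <= ln L.+1%:R.
    by rewrite -ler_expR lnK ?posrE// ltW.
  have h3 := ler_wpM2l (ltW NR0) tK2.
  have : N%:R * A + N%:R * (t * K2) - ln L.+1%:R <= - (N%:R * (del / 2)) by lra.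
  move=> /(ler_wpM2l (ltW t0)); rewrite /a; lra.
Qed.

Lemma achievable_iid :
  (forall q q', in_PSL c Lam q -> in_PSL c Lam q' ->
    Rt <= channel_info P (avg_chan W q) - \sum_s q' s * channel_info P (V s)) ->
  achievable_rc W V c Lam Rt.
Proof.
move=> h.
have [[q0 hq0]|nq] := pselect (exists q, in_PSL c Lam q); last first.
  (* With no admissible [q], both conditions on the level are vacuous. *)
  by apply: (@achievable_of_level 0) => // q hq; case: nq; exists q.
pose E : set R := [set x | exists2 q, in_PSL c Lam q &
  x = \sum_s q s * channel_info P (V s)]%classic.
have ubE q : in_PSL c Lam q -> ubound E (channel_info P (avg_chan W q) - Rt).
  by move=> hq _ [q' hq' ->]; have := h _ _ hq hq'; lra.
have hE : has_sup E.
  split; first by exists (\sum_s q0 s * channel_info P (V s)), q0.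
  by exists (channel_info P (avg_chan W q0) - Rt); exact: ubE.
have inE q : in_PSL c Lam q -> \sum_s q s * channel_info P (V s) <= sup E.
  by move=> hq; apply: sup_upper_bound => //; exists q.
(* The supremum of the leakage is a level that splits the bound on pairs [(q, q')] into one
   condition on each. *)
apply: (@achievable_of_level (sup E)) => //.
- apply: le_trans (inE _ hq0); apply: sumr_ge0 => s _; rewrite mulr_ge0//.
    by case: hq0 => -[].
  exact: channel_info_ge0.
- move=> q hq; rewrite addrC -lerBrDr; apply: ge_sup; last exact: ubE.
  by case: hE.
Qed.

End Achievability.

Theorem theorem4 (R : realType) (X Y Z S : finType)
  (W : S -> X -> Y -> R) (V : S -> X -> Z -> R) (c : S -> R) (Lam : R) :
  channel W -> channel V -> (forall s, 0 <= c s) -> 0 < Lam ->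
  forall Rt : R, 0 <= Rt ->
  (exists (U : finType) (PUX : U * X -> R),
      is_pmf PUX /\
      forall q q' : S -> R, in_PSL c Lam q -> in_PSL c Lam q' ->
        Rt <= mutinfo (joint_UY PUX W q) - Ibar PUX V q') ->
  achievable_rc W V c Lam Rt.
Proof.
move=> hW hV _ _ Rt _ [U [PUX [[PUX0 PUX1] h]]].
pose PU := marg1 PUX.
(* The conditional law of [X] given [U = u]. Where [PU u = 0] any pmf serves, and the marginal of
   [X] is one at hand. *)
pose k u x := if PU u == 0 then marg2 PUX x else PUX (u, x) / PU u.
have PU_pmf : is_pmf PU.
  split=> [u|]; first exact: sumr_ge0.
  by rewrite -PUX1 /PU /marg1 pair_bigA; apply: eq_bigr => -[].
have kE u x : PU u * k u x = PUX (u, x).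
  rewrite /k; case: eqP => [PU0|/eqP PU0]; last by rewrite mulrC divfK.
  rewrite PU0 mul0r; apply/eqP; rewrite eq_sym.
  have /eqP := PU0; rewrite psumr_eq0// => /allP/(_ x).
  by rewrite mem_index_enum => /(_ isT).
have k_pmf u : is_pmf (k u).
  rewrite /k; case: eqP => [_|/eqP PU0]; split=> [x|].
  - exact: sumr_ge0.
  - by rewrite /marg2 exchange_big -PUX1 pair_bigA; apply: eq_bigr => -[].
  - by rewrite divr_ge0//; case: PU_pmf.
  - by rewrite -mulr_suml divff.
have hW' := prefixed_channel k_pmf hW; have hV' := prefixed_channel k_pmf hV.
apply: (achievable_prefixed k_pmf); apply: (achievable_iid PU_pmf hW' hV').
move=> q q' hq hq'; have := h q q' hq hq'.
have hWq u : is_pmf (avg_chan (prefixed k W) q u).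
  by apply: avg_chan_pmf => //; case: hq.
rewrite (@mutinfo_lratioE _ _ _ PU _ hWq); last first.
  move=> u y; rewrite /joint_UY /avg_chan /prefixed mulr_sumr.
  under eq_bigr do rewrite mulr_sumr.
  rewrite exchange_big/=; apply: eq_bigr => s _.
  rewrite mulrCA !mulr_sumr; apply: eq_bigr => x _.
  by rewrite [PU u * _]mulrA kE mulrCA.
rewrite (_ : Ibar PUX V q' = \sum_s q' s * channel_info PU (prefixed k V s))//.
apply: eq_bigr => s _; congr (_ * _).
apply: mutinfo_lratioE => // u z.
rewrite /joint_UZs /prefixed mulr_sumr; apply: eq_bigr => x _.
by rewrite mulrA kE.
Qed.
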